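(* Let $k$ be an algebraically closed field of characteristic $\neq 2$. If $n \geqslant 2$ and $r \geqslant \dfrac{n(n+1)}{2} - 1$, then $\mu(r, n) = 1$.
   Context: $\mathrm{Symm}_n$ denotes the space of symmetric $n \times n$ matrices over $k$. For $A = (A_0, \ldots, A_r) \in \mathrm{Symm}_n^{r+1}$ put $P_A(x_0, \ldots, x_r) = \det(x_0 A_0 + x_1 A_1 + \ldots + x_r A_r)$, and let $H_A$ be the hypersurface $P_A = 0$ in $\mathbb{P}^r$. Hypersurfaces of degree $n$ are regarded as given by their defining degree $n$ forms up to a non-zero scalar, so $H_A = H_B$ means $P_A = c\,P_B$ for some $0 \neq c \in k$. A symmetric presentation of $H_A$ is a tuple $B \in \mathrm{Symm}_n^{r+1}$ with $H_B = H_A$. Two tuples $A, B \in \mathrm{Symm}_n^{r+1}$ are equivalent if there exists $g \in \mathrm{GL}_n(k)$ such that $B_i = g^t A_i g$ for every $i = 0, 1, \ldots, r$. For $r \geqslant 2$, $\mu(r,n)$ denotes the (finite) number of inequivalent symmetric presentations of a general symmetric determinantal hypersurface of degree $n$ in $\mathbb{P}^r$; that is, $\mu(r,n)$ is the number such that, for all $A$ in some non-empty Zariski open subset of $\mathrm{Symm}_n^{r+1}$, the set $\{B \in \mathrm{Symm}_n^{r+1} : H_B = H_A\}$ consists of exactly $\mu(r,n)$ equivalence classes. (Under the hypotheses $n \geqslant 2$ and $r \geqslant n(n+1)/2 - 1$ one has $r \geqslant 2$.) *)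

(* Defs.v *)
(* MathComp, with multinomials for multivariate polynomials. *)
From HB Require Import structures.
From mathcomp Require Import all_boot all_order all_algebra.
From mathcomp.multinomials Require Import mpoly.

Set Implicit Arguments.
Unset Strict Implicit.
Unset Printing Implicit Defensive.

Import GRing.Theory.
Local Open Scope ring_scope.

Section SymmetricDeterminantal.
Variables (k : fieldType) (r n : nat).

Definition mxtuple := 'I_r.+1 -> 'M[k]_n.

Implicit Types A B : mxtuple.

(* A \in Symm_n^(r+1) *)
Definition symm_tuple A : Prop := forall i, (A i)^T = A i.

(* P_A = det (x_0 A_0 + ... + x_r A_r), as a formal polynomial *)
Definition detpoly A : {mpoly k[r.+1]} :=
  \det (\sum_(i < r.+1) 'X_i *: map_mx (@mpolyC r.+1 k) (A i)).

(* H_A = H_B, hypersurfaces being forms up to a nonzero scalar *)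
Definition same_hypersurface A B : Prop :=
  exists2 c : k, c != 0 & detpoly A = c *: detpoly B.

Definition symm_presentation A B : Prop :=
  symm_tuple B /\ same_hypersurface B A.

Definition equivalent A B : Prop :=
  exists2 g : 'M[k]_n, g \in unitmx & forall i, B i = g^T *m A i *m g.

Definition coord_index : finType := ('I_r.+1 * 'I_n * 'I_n)%type.

Definition coords A (t : 'I_#|coord_index|) : k :=
  let: (l, i, j) := enum_val t in A l i j.

(* Symm_n^(r+1) carries the topology induced from the affine space of all
   matrix entries, which is its Zariski topology since it is a linear
   subspace. Only the symmetric elements of U matter. *)
Definition zariski_open (U : mxtuple -> Prop) : Prop :=
  exists S : {mpoly k[#|coord_index|]} -> Prop,
    forall A, symm_tuple A ->
      (U A <-> exists2 p, S p & p.@[coords A] != 0).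

Definition exactly_classes (X : mxtuple -> Prop) (m : nat) : Prop :=
  exists R : 'I_m -> mxtuple,
    [/\ forall s, X (R s),
        forall s t, equivalent (R s) (R t) -> s = t
      & forall B, X B -> exists s, equivalent (R s) B].

End SymmetricDeterminantal.

(* mu(r, n) = m over k; a relation, as mu is specified through the behaviour
   of a general tuple. It is functional in m when k is infinite, because then
   any two nonempty open subsets of Symm_n^(r+1) meet. *)
Definition mu_eq (k : fieldType) (r n m : nat) : Prop :=
  exists U : mxtuple k r n -> Prop,
    [/\ zariski_open U,
        exists2 A, symm_tuple A & U A
      & forall A, symm_tuple A -> U A ->
          exactly_classes (symm_presentation A) m].

(* Main.v *)
(** A general tuple A spans Symm_n, since r + 1 >= n(n+1)/2. If P_B = c P_A,
    then any linear relation among the B_i also holds among the A_i: if the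
    combination of the B_i with coefficients x vanishes, then translation by the
    corresponding combination of the A_i leaves det invariant on Symm_n, so that
    combination is zero. Hence A = T(B) for a linear surjection T of Symm_n that
    multiplies det by a constant. Such a T preserves the symmetric matrices N of
    rank <= 1, because these are exactly the N for which
    det (M + N) + det (M - N) = 2 det M for all symmetric M. After a congruence
    T fixes every E_ii; the images of the rank one matrices attached to
    e_i + a e_j show that T multiplies the (i, j) entry by some eps_ij, and the
    image of the all-ones matrix shows that eps has rank one, so T is a
    congruence. *)
Require Import Defs.
From mathcomp Require Import all_boot all_order all_algebra.
From mathcomp Require Import ring.
From mathcomp.multinomials Require Import mpoly.
Set Implicit Arguments.
Unset Strict Implicit.
Unset Printing Implicit Defensive.
Import GRing.Theory.
Local Open Scope ring_scope.

(** * Diagonalization of symmetric matrices by congruence *)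

Section SymmetricCongruence.
Variable k : closedFieldType.
Hypothesis two_neq0 : 2%:R != 0 :> k.

(** Polarization: for a non-zero entry [N i j], if e_i and e_j are isotropic then e_i + e_j has the
    value 2 [N i j]. *)
Lemma nonisotropic_vector n (N : 'M[k]_n) :
  N^T = N -> N != 0 -> exists u : 'rV_n, (u *m N *m u^T) 0 0 != 0.
Proof.
move=> symN /matrix0Pn[i [j Nij]].
have form p q : ((delta_mx 0 p : 'rV_n) *m N *m (delta_mx 0 q : 'rV_n)^T) 0 0 = N p q.
  by rewrite -rowE trmx_delta -colE !mxE.
have [Nii|Nii] := eqVneq (N i i) 0; last by exists (delta_mx 0 i); rewrite form.
have [Njj|Njj] := eqVneq (N j j) 0; last by exists (delta_mx 0 j); rewrite form.
exists (delta_mx 0 i + delta_mx 0 j).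
have addE (X Y : 'M[k]_1) : (X + Y) 0 0 = X 0 0 + Y 0 0 by rewrite mxE.
rewrite linearD /= !mulmxDl !mulmxDr !addE !form Nii Njj -[in N j i]symN mxE.
by rewrite add0r addr0 -mulr2n -mulr_natl mulf_eq0 negb_or two_neq0 Nij.
Qed.

(** In the rank factorization of [u] the left factor is a scalar and the middle one is e_0, so a
    multiple of [row_ebase u] works. *)
Lemma unitmx_row0 n (u : 'rV[k]_n.+1) :
  u != 0 -> exists2 g : 'M_n.+1, g \in unitmx & row 0 g = u.
Proof.
move=> u0.
have ru : \rank u = 1%N by rewrite rank_rV u0.
have cu := col_ebase_unit u.
set c := col_ebase u 0 0.
have cE : col_ebase u = c%:M by rewrite [LHS]mx11_scalar.
have c0 : c != 0 by move: cu; rewrite cE unitmxE det_scalar1 unitfE.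
exists (c *: row_ebase u); first by rewrite unitmxZ ?unitfE ?row_ebase_unit.
rewrite -[RHS]mulmx_ebase ru cE mul_scalar_mx -scalemxAl linearZ /=; congr (_ *: _).
rewrite rowE; congr (_ *m _); apply/matrixP => i j.
by rewrite !mxE !ord1 eqxx /= eq_sym andbT.
Qed.

(** Induction on [n]: taking a non-isotropic vector as first row of [g] gives [g *m N *m g^T] a
    non-zero corner, and the induction hypothesis applies to its Schur complement. *)
Lemma symm_congr_diag n (N : 'M[k]_n) : N^T = N ->
  exists2 g, g \in unitmx & exists d, N = g^T *m diag_mx d *m g.
Proof.
suff main : N^T = N ->
    exists2 g, g \in unitmx & exists d, g *m N *m g^T = diag_mx d.
  move=> /main[g ug [d gd]]; exists (invmx g)^T; first by rewrite unitmx_tr unitmx_inv.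
  exists d; rewrite -gd trmxK !mulmxA mulVmx // mul1mx -mulmxA -trmx_mul mulVmx //.
  by rewrite trmx1 mulmx1.
elim: n N => [|n IHn] N symN.
  by exists 1%:M; [exact: unitmx1 | exists 0; apply/matrixP; case].
have [->|N0] := eqVneq N 0.
  exists 1%:M; first exact: unitmx1.
  by exists 0; rewrite mulmx0 mul0mx linear0.
have [u uN] := nonisotropic_vector symN N0.
have u0 : u != 0 by apply: contraNneq uN => ->; rewrite !mul0mx mxE.
have [g ug gu] := unitmx_row0 u0.
pose P : 'M_(1 + n) := g *m N *m g^T.
have symP : P^T = P by rewrite !trmx_mul trmxK symN mulmxA.
have P00 : ulsubmx P = ((u *m N *m u^T) 0 0)%:M.
  rewrite [LHS]mx11_scalar; congr (_%:M).
  rewrite -gu -!row_mul !mxE; apply: eq_bigr => i _.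
  rewrite !mxE; congr (_ * _); last by congr (g _ _); apply: val_inj.
  by apply: eq_bigr => j _; congr (g _ _ * _); apply: val_inj.
set c := (u *m N *m u^T) 0 0 in uN P00.
have Pdl : dlsubmx P = (ursubmx P)^T by rewrite trmx_ursub symP.
have Pdr : (drsubmx P)^T = drsubmx P by rewrite trmx_drsub symP.
set b := ursubmx P in Pdl.
have [|h uh [d hd]] := IHn (drsubmx P - c^-1 *: (b^T *m b)).
  by rewrite linearB linearZ /= trmx_mul trmxK Pdr.
(* [L] clears the rest of the first row and column and diagonalizes the Schur complement at once. *)
pose L : 'M_(1 + n) := block_mx 1%:M 0 (- c^-1 *: (h *m b^T)) h.
have detL : \det L = \det h by rewrite det_lblock det1 mul1r.
have LP : L *m P *m L^T = diag_mx (row_mx c%:M d).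
  rewrite diag_mx_row -hd -[P]submxK P00 Pdl -/b /L tr_block_mx !mulmx_block.
  rewrite block_mxKdr !mul1mx !mul0mx !addr0 !trmx1 !trmx0 !mulmx1 !mulmx0 !addr0.
  have -> : - c^-1 *: (h *m b^T) *m c%:M + h *m b^T = 0.
    by rewrite mul_mx_scalar scalerA mulrN mulfV // scaleN1r addNr.
  rewrite mul0mx add0r linearZ /= trmx_mul trmxK mul_scalar_mx scalerA mulrN mulfV //.
  rewrite scaleN1r addNr; congr block_mx.
    by apply/matrixP=> i j; rewrite !mxE !ord1.
  by congr (_ *m _); rewrite mulmxBr -scalemxAr -scalemxAl mulmxA addrC scaleNr.
exists (L *m g); first by rewrite unitmx_mul ug andbT unitmxE detL -unitmxE.
by exists (row_mx c%:M d); rewrite -[RHS]LP /P trmx_mul !mulmxA.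
Qed.

(** * Determinant tests for rank at most one and for zero *)

Lemma det_addsub_rank1 n (M : 'M[k]_n) (v : 'rV_n) :
  \det (M + v^T *m v) + \det (M - v^T *m v) = 2%:R * \det M.
Proof.
(* A Schur complement makes det (M + t v^T v) visibly affine in t. *)
pose B t : 'M_(1 + n) := block_mx 1%:M (- t *: v) v^T M.
have detB t : \det (B t) = \det (M + t *: (v^T *m v)).
  have -> : B t = block_mx 1%:M 0 v^T 1%:M *m
                  block_mx 1%:M (- t *: v) 0 (M + t *: (v^T *m v)).
    rewrite mulmx_block !mul1mx !mulmx1 !mul0mx !addr0 ?add0r; congr block_mx.
    by rewrite -scalemxAr scaleNr addrCA addNr addr0.
  by rewrite det_mulmx det_lblock det_ublock !det1 !mul1r.
have detB0 : \det (B 0) = \det M by rewrite detB scale0r addr0.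
have row'B s t : row' (lshift n 0) (B s) = row' (lshift n 0) (B t).
  by apply/matrixP=> i j; rewrite !mxE; case: splitP => // l; rewrite !ord1 => /esym/eqP.
(* The top row (1, -t v) at t = 1 is twice its value at 0 minus its value at -1. *)
have multi : \det (B 1) = 2%:R * \det (B 0) + (-1) * \det (B (-1)).
  apply: (determinant_multilinear (i0 := lshift n 0)).
  - rewrite !rowKu !row_id; apply/rowP=> j; rewrite !mxE; case: split => l; rewrite !mxE; ring.
  - exact: row'B.
  - exact: row'B.
by rewrite -detB0 -[M + _]/(_ + _) -{1}[v^T *m v]scale1r -scaleN1r -!detB multi mulN1r subrK.
Qed.

Lemma sqrt_exists (x : k) : exists s : k, s * s = x.
Proof.
(* The equation solved is s^2 = x + 0 s; the default of [nth] supplies the coefficient 0. *)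
have [s /eqP] := @solve_monicpoly k 2 (nth 0 [:: x]) isT.
by rewrite !big_ord_recl big_ord0 /= expr0 mulr1 mul0r !addr0 expr2 => /eqP; exists s.
Qed.

Lemma det_congr_diag n (g : 'M[k]_n) (d : 'rV_n) :
  \det (g^T *m diag_mx d *m g) = \det g ^+ 2 * \prod_i d 0 i.
Proof. by rewrite !det_mulmx det_tr det_diag; ring. Qed.

Lemma congr_diagD n (g : 'M[k]_n) (d e : 'rV_n) :
  g^T *m diag_mx d *m g + g^T *m diag_mx e *m g = g^T *m diag_mx (d + e) *m g.
Proof. by rewrite linearD /= mulmxDr mulmxDl. Qed.

Lemma congr_symm n (g M : 'M[k]_n) : M^T = M -> (g^T *m M *m g)^T = g^T *m M *m g.
Proof. by move=> symM; rewrite !trmx_mul trmxK symM mulmxA. Qed.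

Lemma symm_rank1 n (N : 'M[k]_n) : N^T = N ->
    (forall M, M^T = M -> \det (M + N) + \det (M - N) = 2%:R * \det M) ->
  exists w : 'rV_n, N = w^T *m w.
Proof.
move=> symN affN; have [g ug [d Nd]] := symm_congr_diag symN.
have detg : \det g != 0 by rewrite -unitfE -unitmxE.
have d1 i j : i != j -> d 0 i * d 0 j = 0.
  move=> ij; apply/eqP; apply: contraT; rewrite mulf_eq0 negb_or => /andP[di dj].
  (* M and M + N are singular but M - N is not. *)
  pose m := \row_l (if l == i then - d 0 i else if l == j then 0 else 1 + d 0 l).
  have := affN (g^T *m diag_mx m *m g) (congr_symm g (tr_diag_mx m)).
  rewrite Nd -mulNmx -mulmxN -linearN /= !congr_diagD !det_congr_diag.
  rewrite [\prod_l (m + d) 0 l](bigD1 i) //= [\prod_l m 0 l](bigD1 j) //=.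
  rewrite !mxE eqxx addNr eq_sym (negPf ij) eqxx !(mul0r, mulr0) add0r.
  move/eqP; rewrite mulf_eq0 expf_eq0 /= (negPf detg) /=.
  move=> /prodf_eq0[l _]; rewrite !mxE.
  case: (l =P i) => [->|_].
    by rewrite -opprD oppr_eq0 -mulr2n -mulr_natl mulf_eq0 (negPf two_neq0) (negPf di).
  case: (l =P j) => [->|_]; first by rewrite sub0r oppr_eq0 (negPf dj).
  by rewrite addrK oner_eq0.
(* For i != j the product s_i s_j has square d_i d_j = 0, so the outer square of s is diagonal. *)
have [s sE] := fin_all_exists (fun i => sqrt_exists (d 0 i)).
exists (\row_i s i *m g); rewrite trmx_mul mulmxA -(mulmxA g^T) Nd.
congr (_ *m _ *m _); apply/matrixP=> i j.
rewrite !mxE big_ord1 !mxE; case: eqVneq => [<-|ij]; first by rewrite sE.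
have /eqP := d1 _ _ ij; rewrite -!sE mulrACA mulf_eq0 orbb => /eqP ->.
by rewrite mulr0n.
Qed.

Lemma det_translation_eq0 n (N : 'M[k]_n) : N^T = N ->
  (forall M, M^T = M -> \det (M + N) = \det M) -> N = 0.
Proof.
move=> symN invN; have [g ug [d Nd]] := symm_congr_diag symN.
have detg : \det g != 0 by rewrite -unitfE -unitmxE.
suff d0 : d = 0 by rewrite Nd d0 linear0 mulmx0 mul0mx.
apply/rowP=> i; rewrite [RHS]mxE; apply/eqP; apply: contraT => di.
(* This M is singular, while M + N has diagonal d_i at i and 1 elsewhere, up to congruence. *)
pose m := \row_l (if l == i then 0 else 1 - d 0 l).
have := invN (g^T *m diag_mx m *m g) (congr_symm g (tr_diag_mx m)).
rewrite Nd congr_diagD !det_congr_diag [\prod_l m 0 l](bigD1 i) //= !mxE eqxx mul0r mulr0.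
move/eqP; rewrite mulf_eq0 expf_eq0 /= (negPf detg) /=.
move=> /prodf_eq0[l _]; rewrite !mxE.
case: (l =P i) => [->|_]; first by rewrite add0r (negPf di).
by rewrite subrK oner_eq0.
Qed.

(** Lets [ring] check that a goal is a combination of known equations. *)
Lemma eq_of_subr_eq (a b x y : k) : a = b -> x - y = a - b -> x = y.
Proof. by move=> ->; rewrite subrr => /eqP; rewrite subr_eq0 => /eqP. Qed.

Lemma double_eq0 (x : k) : 2%:R * x = 0 -> x = 0.
Proof. by move/eqP; rewrite mulf_eq0 (negPf two_neq0) => /eqP. Qed.

Lemma mx1_sum_delta n : 1%:M = \sum_i delta_mx i i :> 'M[k]_n.
Proof.
rewrite -[1%:M]diag_const_mx diag_mx_sum_delta.
by apply: eq_bigr => i _; rewrite mxE scale1r.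
Qed.

(** * Linear maps preserving rank at most one, or scaling the determinant, on symmetric matrices *)

Section NormalizedPreserver.
Variables (n : nat) (T : {linear 'M[k]_n -> 'M[k]_n}).
Hypothesis T_diag : forall i, T (delta_mx i i) = delta_mx i i.
Hypothesis T_rank1 : forall v : 'rV_n, exists w : 'rV_n, T (v^T *m v) = w^T *m w.

Let S i j : 'M[k]_n := delta_mx i j + delta_mx j i.

Lemma pencil_entry i j a p q :
  T ((delta_mx 0 i + a *: delta_mx 0 j)^T *m (delta_mx 0 i + a *: delta_mx 0 j : 'rV_n)) p q =
  ((p == i) && (q == i))%:R + a ^+ 2 * ((p == j) && (q == j))%:R + a * T (S i j) p q.
Proof.
have -> : (delta_mx 0 i + a *: delta_mx 0 j : 'rV[k]_n)^T = delta_mx i 0 + a *: delta_mx j 0.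
  by rewrite linearD linearZ /= !trmx_delta.
rewrite mulmxDl !mulmxDr -!scalemxAl -!scalemxAr !mul_delta_mx.
have -> : delta_mx i i + a *: delta_mx i j + (a *: delta_mx j i + a *: (a *: delta_mx j j))
   = delta_mx i i + (a ^+ 2) *: delta_mx j j + a *: S i j.
  by apply/matrixP => x y; rewrite !mxE; ring.
by rewrite 2!(linearD T) 2!(linearZ_LR T) /= !T_diag !mxE.
Qed.

Lemma rank1_minor (v : 'rV_n) p q s t :
  T (v^T *m v) p q * T (v^T *m v) s t = T (v^T *m v) p t * T (v^T *m v) s q.
Proof. by have [w ->] := T_rank1 v; rewrite !mxE !big_ord1 !mxE; ring. Qed.

Lemma rank1_image_sym (v : 'rV_n) p q : T (v^T *m v) p q = T (v^T *m v) q p.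
Proof. by have [w ->] := T_rank1 v; rewrite !mxE !big_ord1 !mxE mulrC. Qed.

Lemma T_S_sym i j p q : T (S i j) p q = T (S i j) q p.
Proof.
have := rank1_image_sym (delta_mx 0 i + 1 *: delta_mx 0 j) p q.
by rewrite !pencil_entry !mul1r [(q == i) && _]andbC [(q == j) && _]andbC => /addrI.
Qed.

(** With N = [T (S i j)], the minor on rows i, p and columns i, q reads a N_pq + a^2 (N_ii N_pq -
    N_iq N_pi) = 0; the values a = 1 and a = -1 leave 2 N_pq = 0. *)
Lemma T_S_off i j p q : i != j -> p != i -> q != i -> (p == j) && (q == j) = false ->
  T (S i j) p q = 0.
Proof.
move=> ij pi qi pqj; apply: double_eq0.
have := rank1_minor (delta_mx 0 i + 1 *: delta_mx 0 j) i i p q.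
have := rank1_minor (delta_mx 0 i + (-1) *: delta_mx 0 j) i i p q.
rewrite !pencil_entry pqj !eqxx !(negPf pi) !(negPf qi) !(negPf ij) !andbF /=.
move: (T (S i j)) => N em ep.
by apply: (eq_of_subr_eq (congr2 (fun x y => x - y) ep em)); ring.
Qed.

Lemma T_S_diag i j : i != j -> T (S i j) i i = 0.
Proof.
(* The parameters 1 and -1 alone leave the family T_ii = - T_jj, which a square
   root of -1 rules out. *)
move=> ij; have [s sE] := sqrt_exists (-1).
have minor a := rank1_minor (delta_mx 0 i + a *: delta_mx 0 j) i i j j.
have := minor 1; have := minor (-1); have := minor s.
rewrite !pencil_entry (T_S_sym i j j i) !eqxx !(negPf ij) eq_sym !(negPf ij) /=.
move: (T (S i j)) => N e3 e2 e1.
(* The minor at a reads a^2 + a N_jj + a^3 N_ii + a^2 (N_ii N_jj - N_ij^2) = 0; subtracting its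
   cases 1 and -1 isolates the odd part. *)
have sum0 : N i i + N j j = 0.
  by apply: double_eq0; apply: (eq_of_subr_eq (congr2 (fun x y => x - y) e1 e2)); ring.
have s0 : s != 0 by apply: contra_eq_neq sE => ->; rewrite mul0r eq_sym oppr_eq0 oner_eq0.
(* Adding the cases 1 and s cancels the even part, since s^2 = -1. *)
have diff0 : N j j - N i i = 0.
  apply: (mulfI s0); rewrite mulr0; rewrite expr2 sE in e3.
  have prod := congr1 (fun x => x * (N i i * N j j - N i j * N i j)) sE.
  apply: (eq_of_subr_eq (congr2 (fun x y => x - y) (congr2 +%R e1 e3) (congr2 +%R sum0 prod))).
  by ring.
by apply: double_eq0; apply: (eq_of_subr_eq (congr2 (fun x y => x - y) sum0 diff0)); ring.
Qed.

Lemma T_S_support i j p q :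
  (p, q) != (i, j) -> (q, p) != (i, j) -> T (S i j) p q = 0.
Proof.
rewrite !xpair_eqE; have [<-|ij] := eqVneq i j.
  by move=> /negPf pq _; rewrite (linearD T) /= T_diag !mxE pq addr0.
(* When exactly one of p, q is i, [T_S_off] is applied with i and j exchanged. *)
have SC : S i j = S j i by rewrite /S addrC.
have ji : j != i by rewrite eq_sym.
have [->|pi] := eqVneq p i; have [->|qi] := eqVneq q i; rewrite ?eqxx /=.
- by rewrite T_S_diag.
- by move=> qj _; rewrite SC T_S_off // (negPf qi) andbF.
- by move=> _ pj; rewrite SC T_S_off // (negPf pi).
move=> _ _; case pqj : ((p == j) && (q == j)); last exact: T_S_off.
by move: pqj => /andP[/eqP-> /eqP->]; rewrite SC T_S_diag.
Qed.

(** Twice M is the sum of the [M i j *: S i j]; at the entry (p, q) only the terms with {i, j} = {p,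
    q} survive, and symmetry makes [M p q] a common factor. *)
Lemma T_hadamard (M : 'M_n) p q : M^T = M -> T M p q = M p q * T (const_mx 1) p q.
Proof.
move=> symM; pose X i j := T (S i j) p q.
have TX (L : 'M_n) : L^T = L -> 2%:R * T L p q = \sum_i \sum_j L i j * X i j.
  move=> symL; have -> : 2%:R * T L p q = T (L + L) p q by rewrite (linearD T) mxE; ring.
  rewrite -{2}symL {1}[L]matrix_sum_delta [L in L^T]matrix_sum_delta.
  rewrite linear_sum /= -big_split linear_sum /= summxE; apply: eq_bigr => i _.
  rewrite linear_sum /= -big_split linear_sum /= summxE; apply: eq_bigr => j _.
  by rewrite linearZ /= trmx_delta -scalerDr (linearZ_LR T) mxE.
apply: (mulfI two_neq0); rewrite mulrCA !TX ?trmx_const // big_distrr /=.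
apply: eq_bigr => i _; rewrite big_distrr /=; apply: eq_bigr => j _.
rewrite mxE mul1r.
have [[-> ->] //|h1] := eqVneq (p, q) (i, j).
have [[-> ->]|h2] := eqVneq (q, p) (i, j); first by rewrite -{1}symM mxE.
by rewrite /X T_S_support // !mulr0.
Qed.

Lemma normalized_preserver :
  exists2 g : 'M_n, g \in unitmx & forall M, M^T = M -> T M = g^T *m M *m g.
Proof.
have [w Tw] := T_rank1 (const_mx 1).
have TJ p q : T (const_mx 1) p q = w 0 p * w 0 q.
  have -> : const_mx 1 = (const_mx 1 : 'rV_n)^T *m (const_mx 1 : 'rV_n) :> 'M[k]_n.
    by apply/matrixP=> i j; rewrite !mxE big_ord1 !mxE mulr1.
  by rewrite Tw !mxE big_ord1 !mxE.
have TE (M : 'M_n) : M^T = M -> T M = (diag_mx w)^T *m M *m diag_mx w.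
  move=> symM; apply/matrixP=> p q; rewrite T_hadamard // TJ tr_diag_mx.
  by rewrite mul_mx_diag mxE mul_diag_mx mxE; ring.
exists (diag_mx w) => //.
(* The congruence by [diag_mx w] thus fixes the identity, which makes [diag_mx w] invertible. *)
have T1 : T 1%:M = 1%:M.
  by rewrite mx1_sum_delta linear_sum; apply: eq_bigr.
by have := TE 1%:M (tr_scalar_mx _ _); rewrite T1 mulmx1 => /esym/mulmx1_unit[].
Qed.

End NormalizedPreserver.

Theorem symm_det_preserver n (T : {linear 'M[k]_n -> 'M[k]_n}) (c : k) :
    c != 0 ->
    (forall M, M^T = M -> (T M)^T = T M) ->
    (forall M, M^T = M -> exists2 M', M'^T = M' & T M' = M) ->
    (forall M, M^T = M -> \det (T M) = c * \det M) ->
  exists2 g : 'M_n, g \in unitmx & forall M, M^T = M -> T M = g^T *m M *m g.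
Proof.
move=> c0 symT surjT detT.
have sym_rank1 (v : 'rV[k]_n) : (v^T *m v)^T = v^T *m v by rewrite trmx_mul trmxK.
have T_rank1 (v : 'rV_n) : exists w : 'rV_n, T (v^T *m v) = w^T *m w.
  (* By surjectivity every test matrix is some [T M], so the identity for [v^T *m v] carries over to
     its image. *)
  apply: symm_rank1 => [|_ /surjT[M symM <-]]; first exact/symT/sym_rank1.
  rewrite -linearD -linearB !detT // ?linearD ?linearN /= ?symM ?sym_rank1 //.
  by rewrite -mulrDr det_addsub_rank1 mulrCA.
have dd i : delta_mx i i = (delta_mx 0 i : 'rV_n)^T *m delta_mx 0 i :> 'M[k]_n.
  by rewrite trmx_delta mul_delta_mx.
have exw i : exists w : 'rV_n, T (delta_mx i i) = w^T *m w by rewrite dd; exact: T_rank1.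
have [w wE] := fin_all_exists exw.
(* Undoing the congruence by [W] sends each w_i back to e_i, so [T'] below fixes every E_ii. *)
pose W := \matrix_i w i.
have T1 : T 1%:M = W^T *m W.
  rewrite mx1_sum_delta linear_sum; apply/matrixP=> p q; rewrite summxE [RHS]mxE.
  by apply: eq_bigr => i _; rewrite /= wE !mxE big_ord1 !mxE.
have uW : W \in unitmx.
  rewrite unitmxE unitfE; apply: contraNneq c0 => detW.
  by have := detT 1%:M (tr_scalar_mx _ _); rewrite T1 det_mulmx detW mulr0 det1 mulr1 => <-.
pose T' : {linear 'M[k]_n -> 'M[k]_n} := mulmxr (invmx W) \o (mulmx (invmx W)^T \o T).
have T'E M : T' M = (invmx W)^T *m T M *m invmx W by [].
have T'_rank1 (v w' : 'rV_n) : T (v^T *m v) = w'^T *m w' ->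
    T' (v^T *m v) = (w' *m invmx W)^T *m (w' *m invmx W).
  by move=> Tv; rewrite T'E Tv trmx_mul !mulmxA.
have [||g ug gE] := @normalized_preserver _ T'.
- move=> i; have := wE i; rewrite dd => /T'_rank1 ->.
  have -> : w i *m invmx W = delta_mx 0 i; last by [].
  by rewrite -(rowK w i) -/W -row_mul mulmxV // row1.
- by move=> v; have [w' Tv] := T_rank1 v; exists (w' *m invmx W); exact: T'_rank1.
exists (g *m W) => [|M symM]; first by rewrite unitmx_mul ug.
have -> : (g *m W)^T *m M *m (g *m W) = W^T *m T' M *m W by rewrite gE // trmx_mul !mulmxA.
rewrite T'E !mulmxA.
by rewrite -trmx_mul mulVmx // trmx1 mul1mx mulmxKV.
Qed.

End SymmetricCongruence.

(** * Tuples spanning the symmetric matrices *)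

Section Tuples.
Variables (k : fieldType) (r n : nat).
Implicit Types A B : mxtuple k r n.

Definition lin_comb A (x : 'rV[k]_r.+1) : 'M[k]_n := \sum_i x 0 i *: A i.

(** Flattening turns linear relations among the members into a kernel and their span into a row
    space. *)
Definition tuple_mx A : 'M[k]_(r.+1, n * n) := \matrix_i mxvec (A i).

Lemma mxvec_lin_comb A x : mxvec (lin_comb A x) = x *m tuple_mx A.
Proof.
rewrite mulmx_sum_row /lin_comb linear_sum; apply: eq_bigr => i _.
by rewrite linearZ rowK.
Qed.

Lemma lin_combD A x y : lin_comb A (x + y) = lin_comb A x + lin_comb A y.
Proof. by apply: (can_inj mxvecK); rewrite linearD /= !mxvec_lin_comb mulmxDl. Qed.

Lemma lin_comb_delta A i : lin_comb A (delta_mx 0 i) = A i.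
Proof. by apply: (can_inj mxvecK); rewrite mxvec_lin_comb -rowE rowK. Qed.

Lemma lin_comb_symm A x : symm_tuple A -> (lin_comb A x)^T = lin_comb A x.
Proof.
move=> symA; rewrite /lin_comb linear_sum; apply: eq_bigr => i _.
by rewrite linearZ /= symA.
Qed.

Lemma detpoly_eval A (x : 'rV[k]_r.+1) : (detpoly A).@[fun i => x 0 i] = \det (lin_comb A x).
Proof.
rewrite /detpoly -det_map_mx; congr (\det _); apply/matrixP => p q.
rewrite !mxE !summxE rmorph_sum /=; apply: eq_bigr => i _.
by rewrite !mxE rmorphM /= mevalXU mevalC.
Qed.

Definition spans_symm A :=
  forall M : 'M[k]_n, M^T = M -> exists x, lin_comb A x = M.

Definition sym_pair : finType := {x : 'I_n * 'I_n | (x.1 <= x.2)%N}.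

(** Pairs are counted by their second component j, which admits j + 1 first components. *)
Lemma card_sym_pair : #|sym_pair| = 'C(n.+1, 2).
Proof.
rewrite card_sig -sum1_card.
transitivity (\sum_(j < n) \sum_(i < n | (i <= j)%N) 1)%N.
  rewrite (exchange_big_dep xpredT) //= pair_big_dep /=.
  by apply: eq_bigl => x; rewrite inE.
rewrite -bin2_sum big_mkord big_ord_recl /= add0n; apply: eq_bigr => j _.
transitivity (\sum_(0 <= i < j.+1) 1)%N; last by rewrite sum_nat_const_nat subn0 muln1.
by rewrite (big_nat_widen _ _ n) ?ltn_ord // big_mkord.
Qed.

(* The first n(n+1)/2 members of the tuple are tested for linear independence
   in the coordinates (i, j) with i <= j. *)
Hypothesis pairs_le : (#|sym_pair| <= r.+1)%N.

Let pair_of (b : 'I_#|sym_pair|) : 'I_n * 'I_n := val (enum_val b).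

Definition symm_minor : 'M[{mpoly k[#|coord_index r n|]}]_#|sym_pair| :=
  \matrix_(a, b) 'X_(enum_rank (widen_ord pairs_le a, (pair_of b).1, (pair_of b).2)).

Definition symm_minor_at A : 'M[k]_#|sym_pair| :=
  \matrix_(a, b) A (widen_ord pairs_le a) (pair_of b).1 (pair_of b).2.

Lemma det_symm_minor_eval A : (\det symm_minor).@[coords A] = \det (symm_minor_at A).
Proof.
rewrite -det_map_mx; congr (\det _); apply/matrixP => a b.
by rewrite !mxE /= mevalXU /coords enum_rankK.
Qed.

(** The invertible minor solves for the entries of M with i <= j, using only the first members;
    symmetry gives the others. *)
Lemma symm_minor_spans A :
  symm_tuple A -> \det (symm_minor_at A) != 0 -> spans_symm A.
Proof.
move=> symA; rewrite -unitfE -unitmxE => uA M symM.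
pose m := \row_b M (pair_of b).1 (pair_of b).2.
pose y := m *m invmx (symm_minor_at A).
pose x : 'rV[k]_r.+1 := \sum_a y 0 a *: delta_mx 0 (widen_ord pairs_le a).
have xE : lin_comb A x = \sum_a y 0 a *: A (widen_ord pairs_le a).
  apply: (can_inj mxvecK); rewrite mxvec_lin_comb mulmx_suml linear_sum.
  by apply: eq_bigr => a _; rewrite -scalemxAl -rowE rowK linearZ.
exists x.
have le_case (i j : 'I_n) : (i <= j)%N -> lin_comb A x i j = M i j.
  move=> ij; pose b := enum_rank (Sub (i, j) ij : sym_pair).
  have bE : pair_of b = (i, j) by rewrite /pair_of enum_rankK.
  have : (y *m symm_minor_at A) 0 b = M i j by rewrite mulmxKV // mxE bE.
  by move=> <-; rewrite xE summxE mxE; apply: eq_bigr => a _; rewrite !mxE bE.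
apply/matrixP=> i j; have [/le_case //|/ltnW ji] := leqP i j.
by rewrite -(lin_comb_symm x symA) -symM !mxE le_case.
Qed.

(** Listing the symmetric unit matrices [E], padded by 0, makes the minor the identity. *)
Lemma symm_minor_nonzero : exists2 A, symm_tuple A & \det (symm_minor_at A) != 0.
Proof.
pose E (x : 'I_n * 'I_n) : 'M[k]_n :=
  \matrix_(i, j) (((i, j) == x) || ((j, i) == x))%:R.
pose A (l : 'I_r.+1) := if insub (val l) is Some a then E (pair_of a) else 0.
exists A.
  move=> l; rewrite /A; case: insubP => [a _ _|_]; last by rewrite trmx0.
  by apply/matrixP=> i j; rewrite !mxE orbC.
suff -> : symm_minor_at A = 1%:M by rewrite det1 oner_eq0.
apply/matrixP=> a b; rewrite mxE /A.
have -> : insub (val (widen_ord pairs_le a)) = Some a by exact: (valK a).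
rewrite !mxE -surjective_pairing; congr (nat_of_bool _)%:R.
have pair_inj : injective pair_of by move=> x y /val_inj/enum_val_inj.
have [->|ab] := eqVneq a b; first by rewrite eqxx.
rewrite (inj_eq pair_inj) eq_sym (negPf ab) /=.
(* Two ordered pairs that are swaps of each other lie on the diagonal, hence coincide. *)
apply/negbTE/negP => /eqP swap; case/eqP: ab; apply: pair_inj. 
have := valP (enum_val a); have := valP (enum_val b); rewrite -!/(pair_of _) -swap /=.
move=> le1 le2; have e : (pair_of b).1 = (pair_of b).2 by apply/val_inj/eqP; rewrite eqn_leq le1.
by rewrite [RHS]surjective_pairing -e.
Qed.

End Tuples.

(** * Tuples defining the same hypersurface *)

Section SamePencil.
Variables (k : closedFieldType) (r n : nat).
Hypothesis two_neq0 : 2%:R != 0 :> k.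
Implicit Types A B : mxtuple k r n.

Lemma equivalent_sym A B : equivalent A B -> equivalent B A.
Proof.
move=> [g ug gE]; exists (invmx g) => [|i]; first by rewrite unitmx_inv.
by rewrite gE !mulmxA -trmx_mul mulmxV // trmx1 mul1mx mulmxK.
Qed.

Lemma same_hypersurface_equivalent A B :
  symm_tuple A -> symm_tuple B -> spans_symm A -> same_hypersurface B A ->
  equivalent A B.
Proof.
move=> symA symB spanA [c c0 AB]; apply: equivalent_sym.
have detE x : \det (lin_comb B x) = c * \det (lin_comb A x).
  by rewrite -!detpoly_eval AB mevalZ.
have ker x : lin_comb B x = 0 -> lin_comb A x = 0.
  move=> Bx; apply: (det_translation_eq0 two_neq0 (lin_comb_symm x symA)) => M symM.
  have [y <-] := spanA M symM.
  by apply: (mulfI c0); rewrite -lin_combD -!detE lin_combD Bx addr0.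
(* As relations among the B_i hold among the A_i, the pseudo-inverse yields a matrix sending each
   flattened B_i to A_i. *)
pose X := pinvmx (tuple_mx B) *m tuple_mx A.
have AX : tuple_mx A = tuple_mx B *m X.
  have : (1%:M - tuple_mx B *m pinvmx (tuple_mx B)) *m tuple_mx A = 0.
    apply/row_matrixP=> i; rewrite row_mul row0 -mxvec_lin_comb ker ?linear0 //.
    apply: (can_inj mxvecK); rewrite mxvec_lin_comb -row_mul mulmxBl mul1mx.
    by rewrite mulmxKpV // subrr row0 linear0.
  rewrite mulmxBl mul1mx => /eqP; rewrite subr_eq0 => /eqP.
  by rewrite -(mulmxA _ (pinvmx _)).
(* One inclusion of row spaces and the rank bound from [AX] make them equal, so B spans too. *)
have BA : (tuple_mx B <= tuple_mx A)%MS.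
  apply/row_subP=> i; have [x xE] := spanA (B i) (symB i).
  by rewrite rowK -xE mxvec_lin_comb submxMl.
have rk : (\rank (tuple_mx A) <= \rank (tuple_mx B))%N by rewrite AX mxrankM_maxl.
have AB' : (tuple_mx A <= tuple_mx B)%MS.
  by have := (mxrank_leqif_sup BA).2; rewrite eqn_leq rk mxrankS // => <-.
have spanB : spans_symm B.
  move=> M /spanA[x xE]; have /submxP[y yE] : (mxvec M <= tuple_mx B)%MS.
    by rewrite -xE mxvec_lin_comb (submx_trans (submxMl _ _)).
  by exists y; apply: (can_inj mxvecK); rewrite mxvec_lin_comb.
pose T : {linear 'M[k]_n -> 'M[k]_n} := vec_mx \o (mulmxr X \o mxvec).
have TE x : T (lin_comb B x) = lin_comb A x.
  by rewrite /= mxvec_lin_comb -mulmxA -AX -mxvec_lin_comb mxvecK.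
have [||||g ug gE] := @symm_det_preserver k two_neq0 n T c^-1.
- by rewrite invr_eq0.
- by move=> M /spanB[x <-]; rewrite TE lin_comb_symm.
- by move=> M /spanA[x <-]; exists (lin_comb B x); rewrite ?lin_comb_symm ?TE.
- by move=> M /spanB[x <-]; rewrite TE detE mulKf.
by exists g => // i; rewrite -gE // -[B i]lin_comb_delta TE lin_comb_delta.
Qed.

End SamePencil.

Theorem proposition7 (k : closedFieldType) (r n : nat)
  (char_k : 2%N \notin [pchar k]%R)
  (n_ge2 : (2 <= n)%N)
  (r_ge : ((n * (n + 1)) %/ 2 - 1 <= r)%N) :
  mu_eq k r n 1.
Proof.
have two_neq0 : 2%:R != 0 :> k by move: char_k; rewrite inE.
(* Despite truncated subtraction, N - 1 <= r always gives N <= r + 1, here for N = n(n+1)/2. *)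
have pairs_le : (#|sym_pair n| <= r.+1)%N.
  by move: r_ge; rewrite card_sym_pair bin2 /= mulnC -divn2 addn1 leq_subLR add1n.
(* The open set is the non-vanishing locus of one minor, written as a one-element family to match
   [zariski_open]. *)
exists (fun A => exists2 p, p = \det (symm_minor k pairs_le) & p.@[coords A] != 0).
split.
- by exists (fun p => p = \det (symm_minor k pairs_le)).
- have [A symA detA] := symm_minor_nonzero k pairs_le; exists A => //.
  by exists (\det (symm_minor k pairs_le)) => //; rewrite det_symm_minor_eval.
move=> A symA [p ->]; rewrite det_symm_minor_eval => /(symm_minor_spans symA) spanA.
exists (fun=> A); split=> [_|s t _|B [symB AB]].
- by split=> //; exists 1; rewrite ?oner_eq0 ?scale1r.
- by rewrite !ord1.
- by exists ord0; apply: same_hypersurface_equivalent.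
Qed.
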